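(* Let $\mathcal{N}$ be a nest on a (real or complex) Banach space $\mathbb{X}$, and suppose that there exists a non-trivial idempotent $P\in Alg\,\mathcal{N}$ with range $P(\mathbb{X})\in\mathcal{N}$. If $\delta: Alg\,\mathcal{N}\rightarrow Alg\,\mathcal{N}$ is a continuous linear map which is generalized left derivable at $P$, that is, $\delta(ab)=a\delta(b)+b\delta(a)-ba\delta(I)$ for all $a,b\in Alg\,\mathcal{N}$ with $ab=P$, then $\delta$ is a generalized Jordan left derivation, that is, $\delta(a^{2})=2a\delta(a)-a^{2}\delta(I)$ for all $a\in Alg\,\mathcal{N}$.
   Context: All vector spaces and algebras are over $\mathbb{F}$, where $\mathbb{F}$ is either $\mathbb{R}$ or $\mathbb{C}$. $\mathcal{B}(\mathbb{X})$ denotes the algebra of all bounded linear operators on the Banach space $\mathbb{X}$. A subspace lattice on $\mathbb{X}$ is a collection of norm-closed subspaces of $\mathbb{X}$ which is closed under arbitrary intersections and arbitrary closed linear spans and which contains $\{0\}$ and $\mathbb{X}$. A nest $\mathcal{N}$ on $\mathbb{X}$ is a subspace lattice totally ordered by inclusion. The associated nest algebra is $Alg\,\mathcal{N}=\{T\in\mathcal{B}(\mathbb{X}) : T(N)\subseteq N \text{ for all } N\in\mathcal{N}\}$, with the operator norm; its identity is denoted $I$. A non-trivial idempotent in $Alg\,\mathcal{N}$ is an element $P$ with $P^{2}=P$ and $P\neq 0,I$. Continuity of $\delta$ is with respect to the norm. *)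

(* Defs.v *)
From HB Require Import structures.
From mathcomp Require Import all_boot all_order all_algebra.
From mathcomp Require Import complex.
From mathcomp Require Import boolp classical_sets functions reals topology.
From mathcomp Require Import normedtype.

Set Implicit Arguments.
Unset Strict Implicit.
Unset Printing Implicit Defensive.

Import Order.TTheory GRing.Theory Num.Theory.
Import numFieldNormedType.Exports.

Local Open Scope classical_set_scope.
Local Open Scope ring_scope.

Section BoundedOperators.
Variables (F : numFieldType) (X : normedModType F).

Definition bounded_op (T : X -> X) : Prop :=
  exists M : F, forall x, `|T x| <= M * `|x|.

Definition bounded_linear : {pred X -> X} :=
  fun T => `[< linear T /\ bounded_op T >].

Record boundedOp := BoundedOp {
  bop_fun :> X -> X;
  bop_funP : bounded_linear bop_fun
}.

HB.instance Definition _ := [isSub for bop_fun].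
HB.instance Definition _ := [Choice of boundedOp by <:].

Lemma bounded_linear_submod : submod_closed bounded_linear.
Proof.
split=> [|a T S /asboolP[linT [M TM]] /asboolP[linS [L SL]]].
  apply/asboolP; split=> [b x y|]; first by rewrite -[RHS]/(b *: 0 + 0) scaler0 addr0.
  by exists 0 => x; rewrite normr0 mul0r.
apply/asboolP; split=> [b x y|].
  rewrite -[LHS]/(a *: T (b *: x + y) + S (b *: x + y)).
  rewrite -[RHS]/(b *: (a *: T x + S x) + (a *: T y + S y)).
  by rewrite linT linS !scalerDr !scalerA (mulrC a) addrACA.
exists (`|a| * M + L) => x; rewrite (le_trans (ler_normD _ _))// mulrDl.
by rewrite lerD// normrZ -mulrA ler_wpM2l.
Qed.

HB.instance Definition _ :=
  GRing.isSubmodClosed.Build _ _ bounded_linear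
    (GRing.submod_closed_semi bounded_linear_submod).
HB.instance Definition _ := [SubChoice_isSubLmodule of boundedOp by <:].

Lemma bounded_linear_id : (idfun : X -> X) \in bounded_linear.
Proof. by apply/asboolP; split=> //; exists 1 => x; rewrite mul1r. Qed.

Lemma bounded_linear_comp (T S : boundedOp) : T \o S \in bounded_linear.
Proof.
have /asboolP[linT [M TM]] := bop_funP T.
have /asboolP[linS [L SL]] := bop_funP S.
apply/asboolP; split=> [a x y|]; first by rewrite /= linS linT.
exists (`|M| * L) => x; rewrite (le_trans (TM _))//=.
rewrite (@le_trans _ _ (`|M| * `|S x|))//; last by rewrite -mulrA ler_wpM2l.
have [->|Sx0] := eqVneq (S x) 0; first by rewrite normr0 !mulr0.
have M0 : 0 <= M.
  by rewrite -(pmulr_lge0 _ (_ : 0 < `|S x|)) ?normr_gt0// (le_trans _ (TM _)).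
by rewrite ger0_norm.
Qed.

Definition bop_one := BoundedOp bounded_linear_id.
Definition bop_mul (T S : boundedOp) := BoundedOp (bounded_linear_comp T S).

Lemma bop_mulA : associative bop_mul.
Proof. by move=> T S U; apply: val_inj. Qed.
Lemma bop_mul1 : left_id bop_one bop_mul.
Proof. by move=> T; apply: val_inj. Qed.
Lemma bop_1mul : right_id bop_one bop_mul.
Proof. by move=> T; apply: val_inj. Qed.
Lemma bop_mulDl : left_distributive bop_mul +%R.
Proof. by move=> T S U; apply: val_inj. Qed.
Lemma bop_mulDr : right_distributive bop_mul +%R.
Proof.
move=> T S U; apply: val_inj; apply/funext => x /=.
have /asboolP[linT _] := bop_funP T.
by have := linT 1 (S x) (U x); rewrite !scale1r.
Qed.

(* Only a possibly trivial ring, since X may be the zero space. *)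
HB.instance Definition _ := GRing.Zmodule_isPzRing.Build boundedOp
  bop_mulA bop_mul1 bop_1mul bop_mulDl bop_mulDr.

(* The supremum is taken for the order of F itself. When F = R[i], z <= w means
   that w - z is a nonnegative real, and norms are values z : F with 0 <= z; the
   supremum of a nonempty bounded set of norms then exists and is that of its
   real parts. *)
Definition opnorm (T : boundedOp) : F :=
  supremum 0 [set `|T x| | x in [set x | `|x| <= 1]].

End BoundedOperators.

Section Nests.
Variables (F : numFieldType) (X : normedModType F).

Definition subspace_set (A : set X) : Prop := submod_closed (mem A).

Definition closed_span (A : set X) : set X := closure (smallest subspace_set A).

(* For G empty, the intersection is setT and the closed span is [set 0]. *)
Record subspace_lattice (N : set (set X)) : Prop := {
  lattice_closed_subspace : forall A, N A -> subspace_set A /\ closed A;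
  lattice_bigcap : forall G, G `<=` N -> N (\bigcap_(A in G) A);
  lattice_span : forall G, G `<=` N -> N (closed_span (\bigcup_(A in G) A));
  lattice_0 : N [set 0];
  lattice_T : N setT
}.

Record nest := Nest {
  nest_spaces :> set X -> Prop;
  nest_lattice : subspace_lattice nest_spaces;
  nest_total : total_on nest_spaces subset
}.

End Nests.

Section NestAlgebra.
Variables (F : numFieldType) (X : normedModType F) (N : nest X).

Definition leaves_invariant : {pred boundedOp X} :=
  fun T => `[< forall A, N A -> T @` A `<=` A >].

Record Alg := MkAlg {
  alg_op :> boundedOp X;
  alg_opP : leaves_invariant alg_op
}.

HB.instance Definition _ := [isSub for alg_op].
HB.instance Definition _ := [Choice of Alg by <:].

Lemma leaves_invariantP (T : boundedOp X) :
  reflect (forall A, N A -> forall x, A x -> A (T x)) (T \in leaves_invariant).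
Proof.
apply: (iffP (asboolP _)) => TN A NA; first by move=> x Ax; apply: TN => //; exists x.
by move=> _ [x Ax <-]; exact: TN.
Qed.

Lemma leaves_invariant_submod : submod_closed leaves_invariant.
Proof.
have subN A : N A -> A 0 /\ forall a x y, A x -> A y -> A (a *: x + y).
  move=> /(lattice_closed_subspace (nest_lattice N))[[A0 linA] _].
  split=> [|a x y Ax Ay]; first exact: set_mem.
  by apply: set_mem; apply: linA; apply: mem_set.
split=> [|a T S /leaves_invariantP TN /leaves_invariantP SN].
  by apply/leaves_invariantP => A /subN[].
apply/leaves_invariantP => A NA x Ax; have [_] := subN A NA; apply.
  exact: TN.
exact: SN.
Qed.

Lemma leaves_invariant_subring : subring_closed leaves_invariant.
Proof.
have /GRing.submod_closedB[_ subB] := leaves_invariant_submod.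
split=> [|//|T S /leaves_invariantP TN /leaves_invariantP SN].
  by apply/leaves_invariantP.
by apply/leaves_invariantP => A NA x Ax; apply: TN => //; exact: SN.
Qed.

HB.instance Definition _ := GRing.isSubmodClosed.Build _ _ leaves_invariant
  (GRing.submod_closed_semi leaves_invariant_submod).
HB.instance Definition _ := GRing.isSubringClosed.Build _ leaves_invariant
  leaves_invariant_subring.
HB.instance Definition _ := [SubChoice_isSubLmodule of Alg by <:].
HB.instance Definition _ := GRing.SubZmodule_isSubPzRing.Build
  _ _ Alg leaves_invariant_subring.

Definition opnorm_continuous (delta : Alg -> Alg) : Prop :=
  forall (a : Alg) (e : F), 0 < e -> exists d : F, 0 < d /\
    forall b : Alg, opnorm (b - a) < d -> opnorm (delta b - delta a) < e.

Definition generalized_left_derivable_at (P : Alg) (delta : Alg -> Alg) : Prop :=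
  forall a b, a * b = P ->
    delta (a * b) = a * delta b + b * delta a - b * a * delta 1.

Definition generalized_Jordan_left_derivation (delta : Alg -> Alg) : Prop :=
  forall a, delta (a ^+ 2) = (a * delta a) *+ 2 - a ^+ 2 * delta 1.

End NestAlgebra.

(* Main.v *)
Require Import Defs.
From HB Require Import structures.
From mathcomp Require Import all_boot all_order all_algebra.
From mathcomp Require Import complex.
From mathcomp Require Import boolp classical_sets functions reals topology.
From mathcomp Require Import normedtype.
From mathcomp Require Import lra.

(* Put tau a = delta a - a delta(1), which is left derivable at P, and Q = 1 - P.
   Then Q A P = 0 for A = Alg N. Factorizations of P such as
   (P + m) (P - m b + b) = P, with m in P A Q and P b = 0, give tau m = 0 and
   m (tau b) = 0. The corner P A Q contains the rank one operators e (x) f with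
   e in the range of P and f vanishing there, so by Hahn-Banach m (tau b) = 0
   for all m forces P (tau b) = tau b; hence tau a = tau (a P) lies in P A. On
   P A P, tau (c^-1) = - c^-2 (tau c) for invertible c, and applying this to
   (c (P - c))^-1 = c^-1 + (P - c)^-1 gives tau (c^2) = 2 c (tau c) when P - c
   is invertible too. Completeness of X allows c = k P - a for every a in P A P
   and every large integer k, and the identity for c yields the one for a. *)

Set Implicit Arguments.
Unset Strict Implicit.
Unset Printing Implicit Defensive.
Import Order.TTheory GRing.Theory Num.Theory.
Import numFieldNormedType.Exports.
Local Open Scope classical_set_scope.
Local Open Scope ring_scope.

(** * Left derivable maps at an idempotent of a ring *)

Section LeftDerivableAtIdempotent.
Variables (A : pzRingType) (P : A) (tau : {additive A -> A}).
Hypothesis PP : P * P = P.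
Hypothesis P_stable : forall a, a * P = P * a * P.
Hypothesis tauP : forall a b, a * b = P -> tau P = a * tau b + b * tau a.
Hypothesis corner_faithful : forall b,
  (forall m, P * m = m -> m * P = 0 -> m * b = 0) -> b = P * b.
Hypothesis large_unit : forall a, exists n, forall k, (n <= k)%N ->
  exists u : A, u * (k%:R - a) = 1 /\ (k%:R - a) * u = 1.

Definition in_corner a := P * a = a /\ a * P = a.

(** Mutual inverses in the ring [P A P], whose unit is [P]. *)
Definition corner_inverse c v :=
  [/\ in_corner c, in_corner v, c * v = P & v * c = P].

(** Left multiplication by [P] turns [tau P = P * tau P + P * tau P] into [P * tau P = 0]. *)
Lemma tau_idem : tau P = 0.
Proof.
have tP := tauP PP.
have: P * tau P + 0 = P * tau P + P * tau P.
  by rewrite addr0 {1}tP mulrDr mulrA PP.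
by move/addrI => z; rewrite tP -z addr0.
Qed.

Lemma left_derivable0 a b : a * b = P -> a * tau b + b * tau a = 0.
Proof. by move/tauP <-; exact: tau_idem. Qed.

Lemma P_tau_offdiag m : P * m = m -> m * P = 0 -> P * tau m = 0.
Proof.
move=> Pm mP; have /left_derivable0 : (P + m) * P = P by rewrite mulrDl PP mP addr0.
by rewrite raddfD /= tau_idem mulr0 !add0r.
Qed.

Lemma P_tau_compl b : P * b = 0 -> P * tau b = 0.
Proof.
move=> Pb; have /left_derivable0 : P * (P + b) = P by rewrite mulrDr PP Pb addr0.
by rewrite raddfD /= tau_idem mulr0 add0r addr0.
Qed.

Lemma tau_offdiag_aux m b : P * m = m -> m * P = 0 -> P * b = 0 ->
  b * tau m = 0 /\ m * tau b = m * tau (m * b) + m * b * tau m.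
Proof.
move=> Pm mP Pb.
have bP : b * P = 0 by rewrite P_stable Pb mul0r.
have mm : m * m = 0 by rewrite -{2}Pm mulrA mP mul0r.
have Pmb : P * (m * b) = m * b by rewrite mulrA Pm.
have mbP : m * b * P = 0 by rewrite -mulrA bP mulr0.
have /left_derivable0 : (P + m) * (P - m * b + b) = P.
  rewrite mulrDl !mulrDr !mulrN PP Pb mP Pmb (mulrA m m) mm mul0r.
  by rewrite oppr0 !add0r addr0 subrK.
rewrite !raddfD raddfN /= tau_idem !add0r mulrDl mulrDr mulrN.
rewrite (P_tau_compl Pb) (P_tau_offdiag Pmb mbP) oppr0 !add0r.
rewrite 2!mulrDl (P_tau_offdiag Pm mP) add0r mulrDr mulrN mulNr => E.
(* Left multiplication by [P] kills [b * tau m] and fixes the other terms of [E], so the two parts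
   vanish separately. *)
have F : - (m * tau (m * b)) + m * tau b - m * b * tau m = 0.
  move/(congr1 ( *%R P)): E.
  by rewrite mulr0 !mulrDr !mulrN !mulrA Pb mul0r addr0 Pm.
split; first by move: E; rewrite addrA F add0r.
by move/eqP: F; rewrite subr_eq0 addrC subr_eq => /eqP ->; rewrite addrC.
Qed.

Lemma tau_offdiag m : P * m = m -> m * P = 0 -> tau m = 0.
Proof.
move=> Pm mP; have Q0 : P * (1 - P) = 0 by rewrite mulrBr mulr1 PP subrr.
have [+ _] := tau_offdiag_aux Pm mP Q0.
by rewrite mulrBl mul1r P_tau_offdiag// subr0.
Qed.

(** For [m] in [P A (1 - P)], [m * b] lies there too, so [tau] kills both and [m * tau b = 0];
    faithfulness of the corner concludes. *)
Lemma tau_compl b : P * b = 0 -> tau b = 0.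
Proof.
move=> Pb; rewrite (corner_faithful (b := tau b)) ?P_tau_compl// => m Pm mP.
have bP : b * P = 0 by rewrite P_stable Pb mul0r.
have [_ ->] := tau_offdiag_aux Pm mP Pb.
rewrite (tau_offdiag Pm mP) mulr0 addr0 tau_offdiag ?mulr0 ?mulrA ?Pm//.
by rewrite -mulrA bP mulr0.
Qed.

Lemma corner_inverseC c v : corner_inverse c v -> corner_inverse v c.
Proof. by case. Qed.

(** Both [c * v] and [(c + m) * v] equal [P], and [tau m = 0]; comparing the two relations leaves
    [m * tau v = 0]. *)
Lemma tau_corner_inverse c v : corner_inverse c v -> tau v = P * tau v.
Proof.
case=> _ [Pv vP] cv vc; apply: corner_faithful => m Pm mP.
have /left_derivable0 : (c + m) * v = P.
  by rewrite mulrDl cv -Pv mulrA mP mul0r addr0.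
by rewrite raddfD /= (tau_offdiag Pm mP) addr0 mulrDl addrAC left_derivable0// add0r.
Qed.

Lemma tau_inv c v : corner_inverse c v -> tau v = - (v * v * tau c).
Proof.
move=> cv; have [_ _ cvP vcP] := cv.
move: (congr1 ( *%R v) (left_derivable0 cvP)).
rewrite mulr0 mulrDr !mulrA vcP -(tau_corner_inverse cv) => /eqP.
by rewrite addr_eq0 => /eqP.
Qed.

(* Hua-type identity: c (P - c) has inverse c^-1 + (P - c)^-1 in the corner. *)
Lemma jordan_invertible c v w :
  corner_inverse c v -> corner_inverse (P - c) w ->
  tau (c * c) = (c * tau c) *+ 2.
Proof.
move=> cv; have [[Pc cP] [Pv vP] cvP vcP] := cv.
have [d dE] : exists d, P - c = d by exists (P - c).
rewrite dE => dw; have [[Pd dP] [Pw wP] dwP wdP] := dw.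
have cdC : c * d = d * c by rewrite -dE mulrBr mulrBl Pc cP.
have tc : tau c = P * tau c := tau_corner_inverse (corner_inverseC cv).
have td : tau d = - tau c by rewrite -dE raddfB /= tau_idem sub0r.
have ev : c * d * v = d by rewrite cdC -mulrA cvP dP.
have ew : c * d * w = c by rewrite -mulrA dwP cP.
have e_inv : corner_inverse (v + w) (c * d).
  split; first by split; rewrite ?mulrDl ?mulrDr ?Pv ?vP ?Pw ?wP.
  - by split; rewrite ?mulrA ?Pc// -mulrA dP.
  - rewrite mulrDl mulrA vcP Pd {1}cdC mulrA wdP Pc.
    by rewrite -dE subrK.
  - by rewrite mulrDr ev ew -dE subrK.
have E1 : c * d * (c * d) * (v * v * tau c) = d * d * tau c.
  by rewrite mulrA; congr (_ * _); rewrite mulrA -(mulrA _ (c * d) v) ev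
    {1}cdC -!mulrA (mulrA c d v) ev.
have E2 : c * d * (c * d) * (w * w * tau c) = c * c * tau c.
  by rewrite mulrA; congr (_ * _); rewrite mulrA -(mulrA _ (c * d) w) ew
    -(mulrA c d c) -cdC -!mulrA dwP cP.
(* This yields [tau (c * d) = d * d * tau c - c * c * tau c]; the claim follows from
   [c * c = c - c * d]. *)
have := tau_inv e_inv.
rewrite raddfD /= (tau_inv cv) (tau_inv dw) td mulrN opprK.
rewrite mulrDr mulrN E1 E2.
rewrite opprD opprK => te.
have: tau (c * c) = tau c - tau (c * d).
  by rewrite -raddfB /= -dE mulrBr cP opprB addrC subrK.
rewrite te opprD !opprK => ->.
have dt : d * tau c = tau c - c * tau c by rewrite -dE mulrBl -tc.
have -> : d * d * tau c = tau c - c * tau c - (c * tau c - c * c * tau c).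
  by rewrite -mulrA dt mulrBr (mulrA d) -cdC -mulrA dt mulrBr mulrA.
rewrite [in LHS]opprB [X in _ + X]addrAC subrK opprB addrCA.
by rewrite (addrC (tau c)) subrK mulr2n.
Qed.

(** If [u] inverts [k - a] in the whole ring, [u * P] is the corner inverse; [P_stable] places it in
    the corner. *)
Lemma corner_inverse_large a : in_corner a -> exists n, forall k, (n <= k)%N ->
  exists v, corner_inverse (P *+ k - a) v.
Proof.
move=> [Pa aP]; have [n nP] := large_unit a.
exists n => k /nP[u [uk ku]]; exists (u * P).
have Pk : P * (k%:R - a) = P *+ k - a by rewrite mulrBr Pa mulr_natr.
have kP : (k%:R - a) * P = P *+ k - a by rewrite mulrBl aP mulr_natl.
split.
- by split; rewrite ?mulrBl ?mulrBr ?mulrnAr ?mulrnAl PP ?Pa ?aP.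
- by split; rewrite -?mulrA ?PP// mulrA -P_stable.
- by rewrite -Pk -mulrA (mulrA _ u) ku mul1r PP.
- by rewrite -mulrA -Pk [P * _]mulrA PP Pk -kP mulrA uk mul1r.
Qed.

(** For [c = P *+ n.+1 - a], also [P - c = - (P *+ n - a)] is invertible. Expanding the identity for
    [c], the multiples of [tau a] on both sides cancel. *)
Lemma jordan_corner a : in_corner a -> tau (a * a) = (a * tau a) *+ 2.
Proof.
move=> a_in; have [Pa aP] := a_in.
have [n nP] := corner_inverse_large a_in.
have [v nv] := nP n (leqnn n); have [w nw] := nP n.+1 (leqnSn n).
have ta : tau a = P * tau a.
  have := tau_corner_inverse (corner_inverseC nv).
  by rewrite raddfB raddfMn /= tau_idem mul0rn sub0r mulrN => /oppr_inj.
have nv' : corner_inverse (P - (P *+ n.+1 - a)) (- v).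
  have -> : P - (P *+ n.+1 - a) = - (P *+ n - a).
    by rewrite mulrS !opprB addrCA opprD addNKr.
  have [[Pc cP] [Pv vP] cv vc] := nv.
  by split; [split; rewrite ?mulrN ?mulNr ?Pc ?cP
   | split; rewrite ?mulrN ?mulNr ?Pv ?vP
   | rewrite mulrNN | rewrite mulrNN].
have := jordan_invertible nw nv'; move: n.+1 => k.
rewrite raddfB raddfMn /= tau_idem mul0rn sub0r mulrN.
rewrite !mulrBl !mulrBr !mulrnAr !mulrnAl PP Pa aP -ta.
rewrite !raddfB !raddfMn /= tau_idem !mul0rn mulNrn.
by rewrite add0r addrA -mulr2n !opprK mulrnDl => /addrI.
Qed.

Theorem jordan_of_left_derivable_at a : tau (a * a) = (a * tau a) *+ 2.
Proof.
(* With [y = x - x * P], [tau] kills both [y - P * y], which [P] annihilates from the left, and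
   [P * y], which is in [P A (1 - P)]. *)
have tauE x : tau x = tau (x * P).
  apply/eqP; rewrite -subr_eq0 -raddfB /=; set y := x - x * P.
  have yP : y * P = 0 by rewrite mulrBl -mulrA PP subrr.
  rewrite -(subrK (P * y) y) raddfD /= tau_compl ?tau_offdiag ?addr0//.
  - by rewrite mulrA PP.
  - by rewrite -mulrA yP mulr0.
  - by rewrite mulrBr mulrA PP subrr.
have aP_in : in_corner (a * P) by split; rewrite ?mulrA -?P_stable// -mulrA PP.
have ta : tau a = P * tau a.
  have [n nP] := corner_inverse_large aP_in; have [v nv] := nP n (leqnn n).
  have := tau_corner_inverse (corner_inverseC nv).
  by rewrite raddfB raddfMn /= tau_idem mul0rn sub0r mulrN -tauE => /oppr_inj.
have [PaP _] := aP_in.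
by rewrite tauE -mulrA -PaP mulrA jordan_corner// -tauE -mulrA -ta.
Qed.


End LeftDerivableAtIdempotent.

(** * Invertibility in nest algebras *)

(** The restriction to [0 <= x] makes this apply to [R[i]], where such [x] are the nonnegative
    reals. *)
Definition archimedean (F : numDomainType) :=
  forall x : F, 0 <= x -> exists n : nat, x <= n%:R.

Lemma real_or_complex_archimedean (R : realType) (F : numFieldType) :
  F = (R : numFieldType) \/ F = (R[i] : numFieldType) -> archimedean F.
Proof.
have archiR (x : R) : exists n : nat, x <= n%:R.
  exists (Num.bound `|x|); by rewrite (le_trans (ler_norm x))// ltW// archi_boundP.
case=> -> x; first by move=> _; exact: archiR.
rewrite lecE /= => /andP[/eqP xi _]; have [n xn] := archiR (complex.Re x).
exists n; suff -> : n%:R = (n%:R)%:C%C :> R[i] by rewrite lecE /= xi eqxx.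
by rewrite rmorph_nat.
Qed.

(** * Fixed points of contractions in closed invariant sets *)

Section HalfContraction.
Variables (F : numFieldType) (X : completeNormedModType F).
Hypothesis archiF : archimedean F.
Variable (f : X -> X).
Hypothesis f_half : forall x y, `|f x - f y| <= 2^-1 * `|x - y|.

Lemma half_contraction_fixpoint (A : set X) (x0 : X) :
  closed A -> (forall x, A x -> A (f x)) -> A x0 -> exists2 p, A p & f p = p.
Proof.
move=> clA fA Ax0; pose s n := iter n f x0; pose C := `|f x0 - x0|.
have C_ge0 : 0 <= C := normr_ge0 _.
have s_contr n m : `|s (n + m)%N - s n| <= 2^-1 ^+ n * `|s m - x0|.
  elim: n => [|n IHn]; first by rewrite expr0 mul1r add0n.
  by rewrite addSn /= (le_trans (f_half _ _))// exprS -mulrA ler_wpM2l ?invr_ge0.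
have s_bound n : `|s n - x0| <= C *+ 2.
  elim: n => [|n IHn]; first by rewrite /= subrr normr0 mulrn_wge0.
  rewrite -(subrK (f x0) (s n.+1)) -addrA (le_trans (ler_normD _ _))// mulr2n lerD//.
  rewrite (le_trans (f_half _ _))// (le_trans (ler_wpM2l _ IHn)) ?invr_ge0//.
  by rewrite -[C *+ 2]mulr_natl mulrA mulVf ?mul1r ?pnatr_eq0.
have s_cauchy : cauchy (s n @[n --> \oo]).
  apply/cauchyP => e e0.
  (* As [N < 2 ^ N], this makes the geometric bound [2^-1 ^+ N * (C *+ 2)] smaller than [e]. *)
  have [N CN] : exists N : nat, C *+ 2 / e <= N%:R.
    by apply: archiF; apply: divr_ge0; [exact: mulrn_wge0 | exact: ltW].
  exists (s N); exists N => // n /= Nn.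
  rewrite -ball_normE /= distrC -(subnKC Nn).
  rewrite (le_lt_trans (s_contr _ _))// exprVn mulrC ltr_pdivrMr ?exprn_gt0//.
  rewrite (le_lt_trans (s_bound _))// mulrC -ltr_pdivrMr//.
  by rewrite (le_lt_trans CN)// -natrX ltr_nat ltn_expl.
have /cauchy_cvgP/cvg_ex[p sp] := s_cauchy.
have As n : A (s n) by elim: n => //= n; exact: fA.
exists p.
  by apply: (@closed_cvg _ _ \oo _ s A clA _ p sp); exists 0%N => // n _; exact: As.
(* Otherwise two consecutive iterates within half of [|f p - p|] of [p] would give
   [|f p - p| < |f p - p|]. *)
apply/eqP; rewrite -subr_eq0 -normr_eq0; apply: contraT => fp_neq.
have d0 : 0 < `|f p - p| / 2 by rewrite divr_gt0// lt_def fp_neq normr_ge0.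
have /cvgrPdist_lt/(_ _ d0)[N _ sN] := sp.
suff: `|f p - p| < `|f p - p| by rewrite ltxx.
rewrite -{1}(subrK (s N.+1) (f p)) -addrA (le_lt_trans (ler_normD _ _))//.
rewrite [ltRHS]splitr ltr_leD//; last by rewrite distrC ltW// sN/=.
rewrite (le_lt_trans (f_half _ _))// (le_lt_trans _ (sN N (leqnn N)))//.
by rewrite ler_piMl// invf_le1 ?ler1n.
Qed.
End HalfContraction.

(** * Pointwise calculus in the nest algebra *)

Section AlgPointwise.
Variables (F : numFieldType) (X : normedModType F) (N : nest X).
Implicit Types (a b : Alg N) (x y : X).

Lemma Alg_ext a b : (forall x, a x = b x) -> a = b.
Proof. by move=> ab; apply/val_inj/val_inj/funext => x; exact: ab. Qed.

Lemma Alg_linear a c x y : a (c *: x + y) = c *: a x + a y.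
Proof. by have /asboolP[lina _] := bop_funP a; exact: lina. Qed.

Lemma Alg_bounded a : exists2 M : F, 0 <= M & forall x, `|a x| <= M * `|x|.
Proof.
(* A nonzero vector forces [0 <= M], but on the zero space [M] is arbitrary, hence the absolute
   value. *)
have /asboolP[_ [M aM]] := bop_funP a; exists `|M|; first exact: normr_ge0.
move=> x; have [->|x0] := eqVneq x 0.
  by rewrite (le_trans (aM _))// normr0 !mulr0.
have M0 : 0 <= M.
  by rewrite -(pmulr_lge0 _ (_ : 0 < `|x|)) ?normr_gt0// (le_trans _ (aM _)).
by rewrite ger0_norm.
Qed.

Lemma AlgD a x y : a (x + y) = a x + a y.
Proof. by have := Alg_linear a 1 x y; rewrite !scale1r. Qed.

Lemma Alg0 a : a 0 = 0.
Proof. by have := AlgD a 0 0; rewrite addr0 -{1}[a 0]addr0 => /addrI. Qed.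

Lemma AlgZ a c x : a (c *: x) = c *: a x.
Proof. by have := Alg_linear a c x 0; rewrite !addr0 Alg0 addr0. Qed.

Lemma AlgB a x y : a (x - y) = a x - a y.
Proof. by rewrite AlgD -scaleN1r AlgZ scaleN1r. Qed.

Lemma Alg_natE n x : (n%:R : Alg N) x = x *+ n.
Proof.
elim: n => [//|n IHn]; rewrite !mulrS.
by rewrite -[LHS]/(x + (n%:R : Alg N) x) IHn.
Qed.

Lemma Alg_subE a b x : (a - b) x = a x - b x. Proof. by []. Qed.

Lemma Alg_mulE a b x : (a * b) x = a (b x). Proof. by []. Qed.

Lemma nest_space_linear (A : set X) c x y : N A -> A x -> A y -> A (c *: x + y).
Proof.
move=> /(lattice_closed_subspace (nest_lattice N))[[_ linA] _] Ax Ay.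
by apply: set_mem; apply: linA; apply: mem_set.
Qed.

Lemma ex_Alg (T : X -> X) :
  (forall c x y, T (c *: x + y) = c *: T x + T y) ->
  (exists M : F, forall x, `|T x| <= M * `|x|) ->
  (forall A, N A -> forall x, A x -> A (T x)) ->
  exists a : Alg N, forall x, a x = T x.
Proof.
move=> linT bndT invT.
have bT : bounded_linear T by apply/asboolP; split.
have iT : leaves_invariant N (BoundedOp bT) by apply/leaves_invariantP.
by exists (MkAlg iT).
Qed.

End AlgPointwise.

(** * Inverses of [k - a] for large integers [k] *)

Section LargeUnit.
Variables (F : numFieldType) (X : completeNormedModType F) (N : nest X).
Hypothesis archiF : archimedean F.

Lemma Alg_large_unit (a : Alg N) : exists n : nat, forall k : nat, (n <= k)%N ->
  exists u : Alg N, u * (k%:R - a) = 1 /\ (k%:R - a) * u = 1.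
Proof.
have [M M0 aM] := Alg_bounded a.
have [n Mn] : exists n : nat, M <= n%:R by exact: archiF.
(* From [M <= n] and [k > 2 n] follow [M / k <= 1/2], for the contraction, and [M + 1 <= k], for [D]
   to be bounded below by 1. *)
exists (n + n).+1 => k nk; pose D : Alg N := k%:R - a.
have DE x : D x = x *+ k - a x by rewrite /D Alg_subE Alg_natE.
have k0 : 0 < k%:R :> F by rewrite ltr0n (leq_trans _ nk).
have Mk : M / k%:R <= 2^-1.
  rewrite ler_pdivrMr// ler_pdivlMl// mulr_natl mulr2n (le_trans (lerD Mn Mn))//.
  by rewrite -natrD ler_nat ltnW.
have Mk1 : M + 1 <= k%:R.
  rewrite (le_trans (lerD Mn (lexx 1)))// natr1 ler_nat (leq_trans _ nk)//.
  by rewrite ltnS leq_addr.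
have D_ge x : `|x| <= `|D x|.
  rewrite DE (le_trans _ (lerB_dist _ _))// lerBrDr.
  rewrite (le_trans (lerD (lexx _) (aM x)))//.
  by rewrite -[X in X + _]mul1r -mulrDl addrC normrMn -mulr_natl ler_wpM2r.
have D_inj x y : D x = D y -> x = y.
  move=> Dxy; apply/eqP; rewrite -subr_eq0 -normr_le0 (le_trans (D_ge _))//.
  by rewrite AlgB Dxy subrr normr0.
(* A solution is a fixed point of [k^-1 (y + a x)]. Finding it inside [A] makes the inverse leave
   every space of the nest invariant. *)
have D_surj (A : set X) y : N A -> A y -> exists2 x, A x & D x = y.
  move=> NA Ay; pose f x := k%:R^-1 *: (y + a x).
  have A0 : A 0.
    by have [[/set_mem A0 _] _] := lattice_closed_subspace (nest_lattice N) NA.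
  have clA : closed A by have [] := lattice_closed_subspace (nest_lattice N) NA.
  have [||x Ax fx] := half_contraction_fixpoint archiF (f := f) _ clA _ A0.
  - move=> x z; rewrite -scalerBr opprD addrACA subrr add0r -AlgB normrZ.
    rewrite (le_trans (ler_wpM2l _ (aM _)))// mulrA ler_wpM2r//.
    by rewrite normfV gtr0_norm// mulrC.
  - move=> x Ax; have Aax : A (a x) by have /leaves_invariantP := alg_opP a; exact.
    have := nest_space_linear 1 NA Ay Aax; rewrite scale1r => Ayax.
    by have := nest_space_linear k%:R^-1 NA Ayax A0; rewrite addr0.
  - exists x => //; rewrite DE -scaler_nat -{1}fx /f scalerA divff ?gt_eqF//.
    by rewrite scale1r addrK.
have D_surjT y : exists x, D x = y.
  by have [x _ Dx] := D_surj setT y (lattice_T (nest_lattice N)) Logic.I; exists x.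
have [u uP] := choice D_surjT.
have ulin c x y : u (c *: x + y) = c *: u x + u y.
  by apply: D_inj; rewrite Alg_linear !uP.
have ubnd : exists M : F, forall x, `|u x| <= M * `|x|.
  by exists 1 => x; rewrite mul1r -{2}(uP x) D_ge.
have uinv A : N A -> forall x, A x -> A (u x).
  move=> NA x Ax; have [z Az Dz] := D_surj A x NA Ax.
  by rewrite (_ : u x = z)//; apply: D_inj; rewrite uP.
have [U UE] := ex_Alg ulin ubnd uinv.
exists U; split; apply: Alg_ext => x; last by rewrite Alg_mulE UE; exact: uP.
by apply: D_inj; rewrite Alg_mulE UE; exact: uP.
Qed.
End LargeUnit.

(** * The Hahn-Banach theorem *)

Section HahnBanach.
Variables (R : realType) (F : pzRingType) (rho : {rmorphism R -> F}).
Variable (V : lmodType F).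
Implicit Types (p q : V -> R) (x y : V).

(** Real scalars act through [rho], so that spaces over [R] and over [R[i]] are treated together. *)
Definition sublinear q :=
  (forall x y, q (x + y) <= q x + q y) /\
  (forall t x, 0 < t -> q (rho t *: x) <= t * q x).

Lemma sublinearN_le q x : sublinear q -> - q (- x) <= q x.
Proof.
move=> [qD _]; rewrite -subr_ge0 opprK.
have q0 : 0 <= q 0 by have := qD 0 0; rewrite addr0 lerDl.
by rewrite (le_trans q0)// -(subrr x).
Qed.

Lemma scale_rhoVK t x : 0 < t -> rho t^-1 *: (rho t *: x) = x.
Proof. by move=> t0; rewrite scalerA -rmorphM mulVf ?gt_eqF// rmorph1 scale1r. Qed.

Lemma sublinearZ q t x : sublinear q -> 0 < t -> q (rho t *: x) = t * q x.
Proof.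
move=> [_ qZ] t0; apply/le_anti; rewrite qZ//= -ler_pdivlMl//.
by rewrite -{1}(scale_rhoVK x t0) qZ// invr_gt0.
Qed.

(** The map [q] is the pointwise infimum, kept finite by [b]. It serves for the family in
    [sublinear_below] and for chains in Zorn's lemma. *)
Lemma sublinear_inf (I : Type) (J : set I) (phi : I -> V -> R) (b : V -> R) :
  J !=set0 -> (forall i x, J i -> b x <= phi i x) ->
  (forall i j x y, J i -> J j ->
    exists2 k, J k & phi k (x + y) <= phi i x + phi j y) ->
  (forall i t x, J i -> 0 < t ->
    exists2 k, J k & phi k (rho t *: x) <= t * phi i x) ->
  exists2 q, sublinear q & (forall i x, J i -> q x <= phi i x) /\
    forall x c, (forall i, J i -> c <= phi i x) -> c <= q x.
Proof.
move=> [i0 Ji0] bphi phiD phiZ; pose q x := inf [set phi i x | i in J].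
have q_le i x : J i -> q x <= phi i x.
  move=> Ji; apply: ge_inf; last by exists i.
  by exists (b x) => _ [j Jj <-]; exact: bphi.
have q_ge x c : (forall i, J i -> c <= phi i x) -> c <= q x.
  move=> cphi; apply: lb_le_inf; first by exists (phi i0 x), i0.
  by move=> _ [i Ji <-]; exact: cphi.
exists q; last by split; [exact: q_le | exact: q_ge].
split=> [x y|t x t0].
  rewrite -lerBlDr; apply: (q_ge) => i Ji; rewrite lerBlDr -lerBlDl.
  apply: (q_ge) => j Jj; rewrite lerBlDl.
  by have [k Jk] := phiD i j x y Ji Jj; exact/le_trans/q_le.
rewrite -ler_pdivrMl//; apply: (q_ge) => i Ji; rewrite ler_pdivrMl//.
by have [k Jk] := phiZ i t x Ji t0; exact/le_trans/q_le.
Qed.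

(* The infimum over t > 0 of q (x + t y) - t q y is sublinear and below q. *)
Lemma sublinear_below q y : sublinear q ->
  exists2 q', sublinear q' & forall x, q' x <= q x /\ q' x <= q (x + y) - q y.
Proof.
move=> sq; have [qD _] := sq.
pose phi (t : R) x := q (x + rho t *: y) - t * q y.
have [||||q' sq' [q'_le _]] :=
  @sublinear_inf R [set t | 0 < t] phi (fun x => - q (- x)).
- by exists 1; rewrite /= ltr01.
- move=> t x /= t0; rewrite /phi lerBrDl -(sublinearZ y sq t0).
  by rewrite lerBlDr (le_trans _ (qD _ _))// addrAC subrr add0r.
- move=> s t x z /= s0 t0; exists (s + t); first exact: addr_gt0.
  rewrite /phi rmorphD scalerDl addrACA mulrDl opprD [leRHS]addrACA lerD2r.
  exact: qD.
- move=> s t x /= s0 t0; exists (t * s); first exact: mulr_gt0.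
  rewrite /phi rmorphM -scalerA -scalerDr sublinearZ// mulrBr mulrA.
  exact: lexx.
exists q' => // x; split; last first.
  by rewrite (le_trans (q'_le 1 x ltr01))// /phi rmorph1 scale1r mul1r.
rewrite (le_trans (q'_le 1 x ltr01))// /phi rmorph1 scale1r mul1r lerBlDr.
exact: qD.
Qed.

(** Zorn's lemma for the reversed pointwise order: a nonempty chain is bounded by its infimum,
    finite since [- p (- x)] lies below every member. *)
Lemma minimal_sublinear p : sublinear p ->
  exists2 f, sublinear f /\ (forall x, f x <= p x) &
    forall q, sublinear q -> (forall x, q x <= f x) -> q = f.
Proof.
move=> sp; pose T := {q : V -> R | sublinear q /\ forall x, q x <= p x}.
pose le_rev (s t : T) := `[< forall x, sval t x <= sval s x >].
have [||||f fmax] := @Zorn T le_rev.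
- by move=> t; apply/asboolP.
- move=> r s t /asboolP rs /asboolP st; apply/asboolP => x.
  exact: le_trans (st x) (rs x).
- move=> [s hs] [t ht] /asboolP /= st /asboolP /= ts.
  have E : s = t by apply/funext => x; apply/le_anti; rewrite st ts.
  by subst t; rewrite (Prop_irrelevance hs ht).
- move=> A totA; have [[a0 Aa0]|A0] := pselect (A !=set0); last first.
    by exists (exist _ p (conj sp (fun x => lexx _))) => s As; case: A0; exists s.
  have [||||q sq [q_le _]] :=
    @sublinear_inf T A (fun s => sval s) (fun x => - p (- x)).
  + by exists a0.
  + move=> [s [ss sle]] x As /=; rewrite (le_trans _ (sublinearN_le x ss))//.
    by rewrite lerN2.
  + move=> s t x y As At; have [ss _] := svalP s; have [st _] := svalP t.
    have [/asboolP le|/asboolP le] := totA s t As At.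
      by exists t => //; rewrite (le_trans (st.1 _ _))// lerD2r.
    by exists s => //; rewrite (le_trans (ss.1 _ _))// lerD2l.
  + by move=> s t x As t0; exists s => //; have [[_ +] _] := svalP s; apply.
  have qp x : q x <= p x by rewrite (le_trans (q_le a0 x Aa0))// (svalP a0).2.
  by exists (exist _ q (conj sq qp)) => s As; apply/asboolP => x; exact: q_le.
have [sf fp] := svalP f; exists (sval f) => // q sq qf.
have qp x : q x <= p x by rewrite (le_trans (qf x)).
have fq : le_rev f (exist _ q (conj sq qp)) by apply/asboolP.
by rewrite -(fmax _ fq).
Qed.

Theorem hahn_banach p v : sublinear p -> exists f : V -> R,
  [/\ forall x y, f (x + y) = f x + f y, forall t x, f (rho t *: x) = t * f x,
      forall x, f x <= p x & f v = p v].
Proof.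
(* Lowering [p] to [p'] gives [p' (- v) <= p 0 - p v], which forces [f v = p v] at the end. *)
move=> sp; have [p' sp' p'_le] := sublinear_below v sp.
have [f [sf fp'] fmin] := minimal_sublinear sp'.
have fD x y : f (x + y) = f x + f y.
  (* Minimality gives [q = f], and the second bound on [q] becomes superadditivity of [f]. *)
  have [q sq q_le] := sublinear_below y sf.
  have qf : q = f by apply: fmin => // z; have [] := q_le z.
  apply/le_anti; rewrite sf.1/= -lerBrDr.
  by have [_] := q_le x; rewrite qf.
have f0 : f 0 = 0 by have := fD 0 0; rewrite addr0 -[LHS]addr0 => /addrI.
have fN x : f (- x) = - f x.
  by apply/eqP; rewrite -subr_eq0 opprK -fD addNr f0.
have fp x : f x <= p x by rewrite (le_trans (fp' x))//; have [] := p'_le x.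
exists f; split=> // [t x|].
  have [t0|t0|->] := ltgtP t 0; last by rewrite rmorph0 scale0r f0 mul0r.
    have t0' : 0 < - t by rewrite oppr_gt0.
    by rewrite -[t]opprK rmorphN scaleNr fN (sublinearZ _ sf t0') -mulNr.
  exact: sublinearZ.
apply/le_anti; rewrite fp/= -lerN2 -fN (le_trans (fp' _))//.
have [_] := p'_le (- v); rewrite addNr => /le_trans -> //.
have := sublinearZ 0 sp (ltr0n _ 2); rewrite scaler0 mulr_natl mulr2n.
by rewrite -[LHS]addr0 => /addrI <-; rewrite sub0r.
Qed.
End HahnBanach.

(** * Bounded functionals that do not vanish at a given vector *)

Lemma separating_functional_real (R : realType) (X : normedModType R) (v : X) :
  v <> 0 -> exists f : X -> R,
    [/\ forall c x y, f (c *: x + y) = c * f x + f y,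
        exists2 M : R, 0 <= M & forall x, `|f x| <= M * `|x| & f v <> 0].
Proof.
move=> v0; have normS : sublinear (idfun : {rmorphism R -> R}) (fun x : X => `|x|).
  by split=> [x y|t x t0]; [exact: ler_normD | rewrite normrZ gtr0_norm].
have [f [fD fZ f_le fv]] := hahn_banach v normS.
exists f; split=> [c x y||].
- by rewrite fD -fZ.
- exists 1; first exact: ler01.
  move=> x; rewrite mul1r ler_norml f_le andbT lerNl -mulN1r -fZ scaleN1r.
  by rewrite (le_trans (f_le _))// normrN.
- by rewrite fv => /normr0_eq0.
Qed.

(* A real-linear g is the real part of the complex-linear x |-> g x - i g (i x). *)
Lemma separating_functional_complex (R : realType) (X : normedModType R[i]) (v : X) :
  v <> 0 -> exists f : X -> R[i],
    [/\ forall c x y, f (c *: x + y) = c * f x + f y,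
        exists2 M : R[i], 0 <= M & forall x, `|f x| <= M * `|x| & f v <> 0].
Proof.
move=> v0; pose p (x : X) : R := complex.Re `|x|.
have normE (x : X) : `|x| = (p x)%:C%C.
  have := normr_ge0 x; rewrite lecE /= => /andP[/eqP i0 _].
  by rewrite {1}[`|x|]complexE i0 mulr0 addr0.
have normS : sublinear (real_complex R : {rmorphism R -> R[i]}) p.
  split=> [x y|t x t0].
    by have := ler_normD x y; rewrite !normE -rmorphD lecR.
  by rewrite /p normrZ gtr0_norm ?ltcR// normE -rmorphM.
have [g [gD gZ g_le gv]] := hahn_banach v normS.
have g_norm x : `|g x| <= p x.
  rewrite ler_norml g_le andbT lerNl -mulN1r -gZ rmorphN rmorph1 scaleN1r.
  by rewrite (le_trans (g_le _))// /p normrN.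
(* Multiplication by [i] is isometric, so the real and imaginary parts obey the same bound; hence
   the constant 2 below. *)
have pi x : p ('i%C *: x) = p x.
  apply: complexI; rewrite -!normE normrZ.
  by rewrite [`|'i%C|](_ : _ = 1) ?mul1r// normc_def /= expr0n expr1n add0r sqrtr1.
exists (fun x => (g x -i* g ('i%C *: x))%C); split=> [[s t] x y||].
- have E (z : X) : (s +i* t)%C *: z = s%:C%C *: z + t%:C%C *: ('i%C *: z).
    by rewrite scalerA -scalerDl mulrC; congr (_ *: _); rewrite [LHS]complexE.
  have Ei (z : X) : 'i%C *: ('i%C *: z) = - z.
    by rewrite scalerA (sqr_i R : 'i%C * 'i%C = -1) scaleN1r.
  have iC (z : X) (r : R) : 'i%C *: (r%:C%C *: z) = r%:C%C *: ('i%C *: z) :> X.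
    by rewrite !scalerA mulrC.
  rewrite scalerDr !E scalerDr !iC Ei scalerN.
  have gN z : g (- z) = - g z by rewrite -mulN1r -gZ rmorphN rmorph1 scaleN1r.
  rewrite !gD gN !gZ.
  apply/eqP; rewrite eq_complex /=; apply/andP; split; apply/eqP; lra.
- exists 2%:R; first exact: ler0n.
  move=> x.
  rewrite (_ : (g x -i* _)%C = (g x)%:C%C - 'i%C * (g ('i%C *: x))%:C%C);
    last by simpc.
  rewrite (le_trans (ler_normB _ _))// normrM.
  have -> : `|'i%C : R[i]| = 1 by rewrite normc_def /= expr0n expr1n add0r sqrtr1.
  have normR (r : R) : `|r%:C%C| = `|r|%:C%C.
    by rewrite normc_def /= expr0n addr0 sqrtr_sqr.
  by rewrite mul1r !normR -rmorphD normE mulr_natl mulr2n -rmorphD lecR lerD// -pi.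
- move=> [gv0 _]; apply: v0; apply: normr0_eq0.
  by rewrite normE -gv gv0.
Qed.

Lemma separating_functional (R : realType) (F : numFieldType)
  (hF : F = (R : numFieldType) \/ F = (R[i] : numFieldType))
  (X : normedModType F) (v : X) :
  v <> 0 -> exists f : X -> F,
    [/\ forall c x y, f (c *: x + y) = c * f x + f y,
        exists2 M : F, 0 <= M & forall x, `|f x| <= M * `|x| & f v <> 0].
Proof.
case: hF X v => -> X v; first exact: separating_functional_real.
exact: separating_functional_complex.
Qed.

(** * Nest algebras *)

Section NestAlgebraIdempotent.
Variables (R : realType) (F : numFieldType).
Hypothesis hF : F = (R : numFieldType) \/ F = (R[i] : numFieldType).
Variables (X : completeNormedModType F) (N : nest X) (P : Alg N).
Hypotheses (P_idem : P ^+ 2 = P) (P_neq0 : P <> 0) (P_ran : N (range P)).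

Lemma idem_rangeP y : range P y -> P y = y.
Proof. by move=> [x _ <-]; rewrite -[LHS]/((P * P) x) -expr2 P_idem. Qed.

(** As a space of the nest, [range P] is invariant under [a], and [P] fixes it pointwise. *)
Lemma idem_range_stable (a : Alg N) : a * P = P * a * P.
Proof.
apply: Alg_ext => x; rewrite !Alg_mulE [RHS]idem_rangeP//.
by have /leaves_invariantP := alg_opP a; apply => //; exists x.
Qed.

(* The corner P (Alg N) (1 - P) contains e (x) f for every e in the range of P
   and every functional f vanishing there, as every space of the nest lies
   below or above range P. *)
Lemma idem_corner_faithful (b : Alg N) :
  (forall m : Alg N, P * m = m -> m * P = 0 -> m * b = 0) -> b = P * b.
Proof.
(* If [b x] differs from [P (b x)], choose [f] nonzero at their difference. For
   [m y = f (y - P y) *: P e], the equation [m * b = 0] at [x] forces [P e = 0], for every [e]. *)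
move=> mb; apply: contrapT => bP; apply: P_neq0; apply: Alg_ext => e.
apply: contrapT => Pe; apply: bP; apply: Alg_ext => x; apply: contrapT => bx.
have v0 : b x - P (b x) <> 0 by move/eqP; rewrite subr_eq0 => /eqP.
have [f [flin [M M0 fM] fv]] := separating_functional hF v0.
have PP y : P (P y) = P y by apply: idem_rangeP; exists y.
have f0 : f 0 = 0.
  by rewrite -(scaler0 X (-1)) -{1}(addr0 (-1 *: 0)) flin mulN1r addNr.
have [m mE] : exists m : Alg N, forall y, m y = f (y - P y) *: P e.
  apply: ex_Alg => [c y z||A NA y Ay].
  - by rewrite Alg_linear opprD addrACA -scalerBr flin scalerDl scalerA.
  - have [K K0 QK] := Alg_bounded (1 - P); exists (M * K * `|P e|) => y.
    rewrite normrZ mulrAC ler_wpM2r// (le_trans (fM _))// -mulrA ler_wpM2l//.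
    exact: QK.
  - have A0 : A 0.
      by have [[/set_mem A0 _] _] := lattice_closed_subspace (nest_lattice N) NA.
    have [AP|PA] := nest_total NA P_ran.
      by rewrite (idem_rangeP (AP _ Ay)) subrr f0 scale0r.
    have APe : A (P e) by apply: PA; exists e.
    by have := nest_space_linear (f (y - P y)) NA APe A0; rewrite addr0.
have Pm : P * m = m by apply: Alg_ext => y; rewrite Alg_mulE !mE AlgZ PP.
have mP : m * P = 0.
  by apply: Alg_ext => y; rewrite Alg_mulE !mE PP subrr f0 scale0r.
have /(congr1 (fun c : Alg N => c x)) := mb m Pm mP.
rewrite Alg_mulE mE => /eqP; rewrite scaler_eq0 => /orP[] /eqP //.
Qed.
End NestAlgebraIdempotent.

Theorem theorem2p6 (R : realType) (F : numFieldType)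
  (hF : F = (R : numFieldType) \/ F = (R[i] : numFieldType))
  (X : completeNormedModType F) (N : nest X)
  (P : Alg N) (hPidem : P ^+ 2 = P) (hP0 : P <> 0) (hP1 : P <> 1)
  (hPran : N (range P))
  (delta : {linear Alg N -> Alg N}) (hcont : opnorm_continuous delta)
  (hder : generalized_left_derivable_at P delta) :
  generalized_Jordan_left_derivation delta.
Proof.
(* This correction absorbs the term [b * a * delta 1]: when [a * b = P], the hypothesis becomes
   [tau (a * b) = a * tau b + b * tau a]. *)
pose tau (a : Alg N) : Alg N := delta a - a * delta 1.
have tau_morph : zmod_morphism tau.
  by move=> a b; rewrite /tau raddfB /= mulrBl !opprD addrACA.
pose tauA : {additive Alg N -> Alg N} :=
  HB.pack tau (GRing.isZmodMorphism.Build _ _ tau tau_morph).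
have PP : P * P = P by rewrite -expr2.
have tauP (a b : Alg N) : a * b = P -> tauA P = a * tauA b + b * tauA a.
  move=> abP; have dab := hder a b abP; rewrite -abP.
  rewrite -[LHS]/(delta (a * b) - a * b * delta 1) dab.
  rewrite -[tauA b]/(delta b - b * delta 1) -[tauA a]/(delta a - a * delta 1).
  by rewrite !mulrBr !mulrA [RHS]addrACA -!addrA [X in _ = _ + (_ + X)]addrC.
have large := Alg_large_unit (real_or_complex_archimedean hF) (N := N).
move=> a; have := jordan_of_left_derivable_at PP (idem_range_stable hPidem hPran)
  tauP (idem_corner_faithful hF hPidem hP0 hPran) large a.
rewrite -[tauA (a * a)]/(delta (a * a) - a * a * delta 1).
rewrite -[tauA a]/(delta a - a * delta 1).
rewrite mulrBr mulrA -expr2 mulrnBl => /eqP.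
rewrite subr_eq => /eqP ->.
by rewrite mulr2n opprD addrA subrK.
Qed.
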